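(* Let $n,m\ge 1$, let $\Omega$ be an open set in $\mathbb{R}^n\times\mathbb{R}^m$, with variable denoted $(x,y)$, where $x\in\mathbb{R}^n$ and $y\in\mathbb{R}^m$, and let $F:\Omega\to\mathbb{R}^m$ be differentiable (at every point of $\Omega$). Suppose that $(a,b)$ is a point in $\Omega$ such that $F(a,b)=0$ and $\det\frac{\partial F}{\partial y}(a,b)\neq 0$, with the matrix-valued function $\frac{\partial F}{\partial y}(x,y)$ continuous at $(a,b)$. Then there exists an open set $X\times Y$ (with $X\subseteq\mathbb{R}^n$ and $Y\subseteq\mathbb{R}^m$), contained in $\Omega$ and containing $(a,b)$, satisfying the following conditions. (1) There exists a unique function $g:X\to Y$ that satisfies $F(x,g(x))=0$ for all $x$ in $X$. (2) We have $g(a)=b$. Moreover, the map $g:X\to Y$ is differentiable and $$Jg(x)=-\left[\frac{\partial F}{\partial y}(x,g(x))\right]^{-1}_{m\times m}\left[\frac{\partial F}{\partial x}(x,g(x))\right]_{m\times n},\quad\text{for all } x \text{ in } X.$$ In addition, if $JF(x,y)$ is continuous at $(a,b)$, then $Jg(x)$ is continuous at $x=a$.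
   Context: Differentiable means (Fréchet) differentiable at every point of the domain. For $F=(F_1,\dots,F_m)$, with $x=(x_1,\dots,x_n)$ and $y=(y_1,\dots,y_m)$, write $\frac{\partial F}{\partial y}=\left(\frac{\partial F_i}{\partial y_j}\right)_{1\le i,j\le m}$ (an $m\times m$ matrix) and $\frac{\partial F}{\partial x}=\left(\frac{\partial F_i}{\partial x_k}\right)_{1\le i\le m,\,1\le k\le n}$ (an $m\times n$ matrix). $JF$ and $Jg$ denote the full Jacobian matrices (matrices of all first-order partial derivatives), regarded as functions on the respective domains. A product set $X\times Y$ is open if and only if $X$ and $Y$ are open. *)

(* Defs.v *)
From HB Require Import structures.
From mathcomp Require Import all_boot all_order all_algebra.
From mathcomp Require Import all_classical all_reals all_analysis.

Set Implicit Arguments.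
Unset Strict Implicit.
Unset Printing Implicit Defensive.

Import Order.TTheory GRing.Theory Num.Theory.
Import numFieldNormedType.Exports.

Local Open Scope classical_set_scope.
Local Open Scope ring_scope.

(* Entry (i, k) is the partial derivative of f_i in the k-th variable, so the
   matrix has one row per component of f: it acts on column vectors, unlike the
   library's ['J f x], of which it is the transpose (jac_trE). *)
Definition jac (R : realType) (p q : nat) (f : 'rV[R]_p -> 'rV[R]_q)
    (x : 'rV[R]_p) : 'M[R]_(q, p) :=
  \matrix_(i < q, k < p) 'D_(delta_mx 0 k) (fun z => f z 0 i) x.

Definition jacx (R : realType) (n m q : nat)
    (F : 'rV[R]_n * 'rV[R]_m -> 'rV[R]_q) (z : 'rV[R]_n * 'rV[R]_m) :
    'M[R]_(q, n) :=
  jac (fun x => F (x, z.2)) z.1.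

Definition jacy (R : realType) (n m q : nat)
    (F : 'rV[R]_n * 'rV[R]_m -> 'rV[R]_q) (z : 'rV[R]_n * 'rV[R]_m) :
    'M[R]_(q, m) :=
  jac (fun y => F (z.1, y)) z.2.

Definition jacxy (R : realType) (n m q : nat)
    (F : 'rV[R]_n * 'rV[R]_m -> 'rV[R]_q) (z : 'rV[R]_n * 'rV[R]_m) :
    'M[R]_(q, n + m) :=
  row_mx (jacx F z) (jacy F z).

(* Functions X -> Y are total functions mapping X into Y; their values outside
   X are irrelevant, and two of them are the same function when they agree
   on X. *)
Definition implicit_function (R : realType) (n m q : nat)
    (F : 'rV[R]_n * 'rV[R]_m -> 'rV[R]_q)
    (X : set 'rV[R]_n) (Y : set 'rV[R]_m) (g : 'rV[R]_n -> 'rV[R]_m) : Prop :=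
  set_fun X Y g /\ forall x, X x -> F (x, g x) = 0.

Lemma jac_trE (R : realType) (p q : nat) (f : 'rV[R]_p -> 'rV[R]_q)
    (x : 'rV[R]_p) :
  differentiable f x -> jac f x = ('J f x)^T.
Proof.
move=> df; apply/matrixP => i k; rewrite !mxE.
have /derive_mx/matrixP/(_ 0 i) : derivable f x (delta_mx 0 k).
  exact: diff_derivable.
by rewrite mxE => <-; rewrite deriveE.
Qed.

(* Main.v *)
Require Import Defs.
From HB Require Import structures.
From mathcomp Require Import all_boot all_order all_algebra.
From mathcomp Require Import all_classical all_reals all_analysis.
From mathcomp Require Import lra.

(** Let A be the partial Jacobian of F in y at (a, b).  The zeros of F(x, .) are
    the fixed points of the chord-Newton map y |-> y - A^-1 F(x, y).  Its
    y-derivative is 1 - A^-1 dF/dy, which vanishes at (a, b), so continuity of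
    dF/dy at that single point makes it small on a whole product of balls.  A
    pointwise bound on the derivative along a segment is just what the mean value
    inequality asks for ([mean_value_norm_le], through [linearization_norm_le]),
    so that on this product the map halves the distances within each slice.
    This one estimate gives everything but differentiability:
    - at most one zero of F(x, .), and exactly one when F(x, b) is small, by
      Banach's theorem on a closed ball ([contraction_ball_fixpoint]); this
      defines g, with g a = b;
    - continuity of g, as the distance from g x' to g x is at most twice the
      size of A^-1 F(x', g x), which tends to 0 when x' tends to x.
    The same bound on dF/dy - A makes dF/dy invertible all over the product
    ([unitmx_of_approx]).

    Differentiability is then a pointwise matter ([implicit_differentiation]): in
    the first-order expansion of F at (x, g x), where F keeps the value 0, the term
    dF/dy (g x' - g x) can be solved for, and the error o(|dx| + |dg|) is an
    o(|dx|) because the resulting equation itself bounds |dg| by a multiple of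
    |dx|.  Continuity of the Jacobian of g at a follows from its formula, since
    inversion of matrices is continuous ([cvg_invmx]).

    A Jacobian acts on column vectors whereas points are row vectors, so that
    the linear map of matrix J appears below as v |-> v *m J^T. *)

Set Implicit Arguments.
Unset Strict Implicit.
Unset Printing Implicit Defensive.

Import Order.TTheory GRing.Theory Num.Theory.
Import numFieldNormedType.Exports.

Local Open Scope classical_set_scope.
Local Open Scope ring_scope.

(** * Norm, limits and inverses of matrices *)

(** Banach's fixed point theorem is stated for spaces that are complete and normed
    at once. *)
HB.instance Definition _ (R : realType) (m n : nat) :=
  Complete.on 'M[R]_(m, n).

Lemma entry_le_mx_norm (R : realType) (m n : nat) (M : 'M[R]_(m, n)) i j :
  `|M i j| <= `|M|.
Proof.
rewrite [leRHS]/Num.norm/= mx_normrE; apply/bigmax_geP; right => /=.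
by exists (i, j).
Qed.

Lemma mx_norm_le (R : realType) (m n : nat) (M : 'M[R]_(m, n)) (c : R) :
  0 <= c -> (forall i j, `|M i j| <= c) -> `|M| <= c.
Proof.
move=> c0 Mc; rewrite [leLHS]/Num.norm/= mx_normrE.
by apply/bigmax_leP; split => // -[i j] _; exact: Mc.
Qed.

(** The matrix norm is the largest absolute value of an entry, which is not
    submultiplicative: hence the factor n. *)
Lemma mulmx_norm_le (R : realType) (m n p : nat) (A : 'M[R]_(m, n))
    (B : 'M[R]_(n, p)) : `|A *m B| <= n%:R * `|A| * `|B|.
Proof.
apply: mx_norm_le => [|i j]; first by rewrite !mulr_ge0.
rewrite mxE (le_trans (ler_norm_sum _ _ _))//.
rewrite (@le_trans _ _ (\sum_(k < n) `|A| * `|B|))//.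
  apply: ler_sum => k _.
  by rewrite normrM ler_pM// entry_le_mx_norm.
by rewrite sumr_const card_ord -mulrA mulr_natl.
Qed.

Lemma cvg_mxP (R : realType) (T : Type) (F : set_system T) {FF : Filter F}
    (m n : nat) (f : T -> 'M[R]_(m, n)) (M : 'M[R]_(m, n)) :
  f @ F --> M <-> forall i j, (f x i j @[x --> F] --> M i j).
Proof.
split=> [fM i j|fM].
  exact: (cvg_comp _ _ fM (@coord_continuous R m n i j M)).
apply/cvgrPdist_le => e e0.
have : \forall x \near F, forall i j, `|M i j - f x i j| <= e.
  apply: filter_forall => i; apply: filter_forall => j.
  exact: cvgr_dist_le (fM i j) e e0.
apply: filterS => x fx; apply: mx_norm_le; first exact: ltW.
by move=> i j; rewrite !mxE.
Qed.

Lemma cvg_mulmx (R : realType) (T : Type) (F : set_system T) {FF : Filter F}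
    (m n p : nat) (f : T -> 'M[R]_(m, n)) (g : T -> 'M[R]_(n, p))
    (A : 'M[R]_(m, n)) (B : 'M[R]_(n, p)) :
  f @ F --> A -> g @ F --> B -> f x *m g x @[x --> F] --> A *m B.
Proof.
move=> /cvg_mxP fA /cvg_mxP gB; apply/cvg_mxP => i j.
under eq_fun do rewrite mxE.
rewrite mxE; apply: cvg_big => [|k _]; first exact: add_continuous.
exact: cvgM.
Qed.

(** Leibniz' formula makes the determinant a polynomial in the entries. *)
Lemma cvg_det (R : realType) (T : Type) (F : set_system T) {FF : Filter F}
    (n : nat) (f : T -> 'M[R]_n) (A : 'M[R]_n) :
  f @ F --> A -> \det (f x) @[x --> F] --> \det A.
Proof.
move=> /cvg_mxP fA; apply: cvg_big => [|s _]; first exact: add_continuous.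
apply: cvgM; first exact: cvg_cst.
by apply: cvg_big => [|i _]; [exact: mul_continuous|exact: fA].
Qed.

(** Cramer's rule expresses the inverse by determinants, near an invertible
    limit where the determinant stays nonzero. *)
Lemma cvg_invmx (R : realType) (T : Type) (F : set_system T) {FF : Filter F}
    (n : nat) (f : T -> 'M[R]_n) (A : 'M[R]_n) :
  A \in unitmx -> f @ F --> A -> invmx (f x) @[x --> F] --> invmx A.
Proof.
move=> uA fA; have dA : \det A != 0 by rewrite -unitfE -unitmxE.
have dfA : \det (f x) @[x --> F] --> \det A by exact: cvg_det.
have nz : \forall x \near F, \det (f x) != 0 by apply: cvgr_neq0 dfA dA.
have : (\det (f x))^-1 *: \adj (f x) @[x --> F] --> (\det A)^-1 *: \adj A.
  apply: cvgZ; first exact: cvgV.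
  apply/cvg_mxP => i j; rewrite !mxE.
  under eq_fun do rewrite mxE.
  apply: cvgM; first exact: cvg_cst.
  apply: cvg_det; apply/cvg_mxP => k l; under eq_fun do rewrite !mxE.
  by rewrite !mxE; move/cvg_mxP : fA; exact.
rewrite {2}/invmx uA; apply: cvg_trans.
apply: near_eq_cvg; near=> x.
rewrite /invmx unitmxE unitfE ifT//; near: x; exact: nz.
Unshelve. all: by end_near. Qed.

(** * Differentials and Jacobian matrices *)

Lemma diff_jac (R : realType) (p q : nat) (f : 'rV[R]_p -> 'rV[R]_q) x v :
  differentiable f x -> 'd f x v = v *m (jac f x)^T.
Proof. by move=> df; rewrite jac_trE// trmxK /jacobian mul_rV_lin1. Qed.

Lemma jac_val (R : realType) (p q : nat) (f : 'rV[R]_p -> 'rV[R]_q)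
    (x : 'rV[R]_p) (J : 'M[R]_(q, p)) :
  is_diff x f (fun v => v *m J^T) -> jac f x = J.
Proof.
move=> df; apply: trmx_inj; apply/row_matrixP => k.
by rewrite !rowE -diff_jac// diff_val.
Qed.

Lemma mulmxr_continuous (R : realType) (m n p : nat) (M : 'M[R]_(n, p)) :
  continuous (mulmxr M : 'M[R]_(m, n) -> 'M[R]_(m, p)).
Proof.
move=> u; rewrite /continuous_at /=.
by apply: (@cvg_mulmx R _ (nbhs u) _ _ _ _ id (cst M) u) => //; exact: cvg_cst.
Qed.

Lemma is_diff_mulmxr (R : realType) (m n p : nat) (M : 'M[R]_(n, p))
    (u : 'M[R]_(m, n)) : is_diff u (mulmxr M) (mulmxr M).
Proof.
apply: DiffDef.
  by apply: linear_differentiable; exact: mulmxr_continuous.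
by rewrite diff_lin//; exact: mulmxr_continuous.
Qed.

(** First-order expansion with explicit errors, as a way to prove
    differentiability and compute the Jacobian in one go. *)
Lemma differentiable_jacP (R : realType) (p q : nat)
    (f : 'rV[R]_p -> 'rV[R]_q) (x : 'rV[R]_p) (J : 'M[R]_(q, p)) :
  (forall e, 0 < e -> \forall h \near (0 : 'rV[R]_p),
     `|f (h + x) - f x - h *m J^T| <= e * `|h|) ->
  differentiable f x /\ jac f x = J.
Proof.
move=> fJ; have fE : f \o shift x = cst (f x) + mulmxr J^T +o_ 0 id.
  apply/eqaddoP => e e0; apply: filterS (fJ e e0) => h.
  by rewrite /= !fctE /= opprD addrA.
have dE := diff_unique (@mulmxr_continuous _ _ _ _ J^T) fE.
have df : differentiable f x.
  by apply/diff_locallyP; rewrite dE; split => //; exact: mulmxr_continuous.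
by split => //; apply: jac_val; exact: DiffDef.
Qed.

Lemma differentiable_dist_le (R : realType) (U V : normedModType R)
    (f : U -> V) (x : U) (e : R) : differentiable f x -> 0 < e ->
  \forall h \near (0 : U), `|f (h + x) - f x - 'd f x h| <= e * `|h|.
Proof.
move=> /diff_locallyP[_ /eqaddoP fx] e0.
by apply: filterS (fx e e0) => h; rewrite /= !fctE /= opprD addrA.
Qed.

(** The mean value theorem is false for vector-valued maps, but with the maximum
    norm it is enough to apply it to each coordinate along the segment. *)
Lemma mean_value_norm_le (R : realType) (p q : nat) (f : 'rV[R]_p -> 'rV[R]_q)
    (x y : 'rV[R]_p) (c : R) : 0 <= c ->
    (forall t : R, t \in `[0, 1] -> differentiable f (x + t *: (y - x))) ->
    (forall t : R, t \in `[0, 1] -> `|jac f (x + t *: (y - x))| <= c) ->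
  `|f y - f x| <= p%:R * `|y - x| * c.
Proof.
move=> c0 df jf; apply: mx_norm_le => [|i j]; first by rewrite !mulr_ge0.
pose path := cst x + *:%R^~ (y - x) : R -> 'rV[R]_p.
pose h (t : R) := f (path t) i j.
have dpath (t : R) : is_diff t path (0 + *:%R^~ (y - x)) by exact: is_diffD.
have dh (t : R) : t \in `[0, 1] ->
    is_derive t 1 h (((y - x) *m (jac f (path t))^T) i j).
  move=> t01; have dft : differentiable f (path t) by exact: df.
  have dfp : derivable (f \o path) t 1.
    by apply: diff_derivable; exact: differentiable_comp.
  apply: DeriveDef; first by move/derivable_mxP : dfp; exact.
  have /matrixP/(_ i j) := derive_mx dfp; rewrite mxE => <-.
  rewrite deriveE; last exact: differentiable_comp.
  by rewrite diff_comp// diff_val/= diff_jac// fctE add0r scale1r.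
have hc : {within `[0, 1], continuous h}.
  by apply: derivable_within_continuous => t /dh[].
have [t t01] := MVT_segment ler01 (fun t t01 => dh t (subset_itv_oo_cc t01)) hc.
rewrite subr0 mulr1 /h /path /= !fctE scale1r subrKC scale0r addr0 => hE.
rewrite !mxE hE (le_trans (entry_le_mx_norm _ _ _))//.
rewrite (le_trans (mulmx_norm_le _ _))// ler_wpM2l ?mulr_ge0//.
rewrite mx_norm_le// => k l; rewrite mxE.
by rewrite (le_trans (entry_le_mx_norm _ _ _))// jf.
Qed.

Section PartialJacobians.
Variables (R : realType) (n m q : nat) (F : 'rV[R]_n * 'rV[R]_m -> 'rV[R]_q).
Variables (z : 'rV[R]_n * 'rV[R]_m).
Hypothesis dF : differentiable F z.

Lemma is_diff_slicex :
  is_diff (z.1) (fun x => F (x, z.2)) (fun u => 'd F z (u, 0)).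
Proof.
have dz : is_diff (z.1) (fun x : 'rV[R]_n => (x, z.2)) (fun u => (u, 0)).
  exact: is_diff_pair.
have dFz : is_diff ((fun x => (x, z.2)) z.1) F ('d F z).
  by rewrite -surjective_pairing; exact: differentiableP.
exact: (is_diff_comp dz dFz).
Qed.

Lemma is_diff_slicey :
  is_diff (z.2) (fun y => F (z.1, y)) (fun v => 'd F z (0, v)).
Proof.
have dz : is_diff (z.2) (fun y : 'rV[R]_m => (z.1, y)) (fun v => (0, v)).
  exact: is_diff_pair.
have dFz : is_diff ((fun y => (z.1, y)) z.2) F ('d F z).
  by rewrite -surjective_pairing; exact: differentiableP.
exact: (is_diff_comp dz dFz).
Qed.

(** Each partial Jacobian is the Jacobian of a slice, and by the chain rule a
    slice is differentiated by restricting the differential of F. *)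
Lemma diff_jacxy u v :
  'd F z (u, v) = u *m (jacx F z)^T + v *m (jacy F z)^T.
Proof.
have -> : (u, v) = (u, 0) + (0, v) :> 'rV[R]_n * 'rV[R]_m.
  by congr pair; rewrite /= ?addr0 ?add0r.
rewrite linearD; congr (_ + _).
  have d := is_diff_slicex.
  by rewrite -diff_jac// diff_val.
have d := is_diff_slicey.
by rewrite -diff_jac// diff_val.
Qed.

End PartialJacobians.

(** * Linear approximation of an implicit equation *)

(** Multiplication by the inverse turns a residual into an error.  With A near the
    partial Jacobian of F in y this is the estimate for the chord map; with A equal
    to it, it solves a first-order expansion for the increment of g. *)
Lemma solve_approx (R : realType) (m p : nat) (A : 'M[R]_m) (v w : 'M[R]_(p, m))
    (e : R) : A \in unitmx -> `|w - v *m A^T| <= e ->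
  `|v - w *m (invmx A)^T| <= m%:R * `|(invmx A)^T| * e.
Proof.
move=> uA we; have -> : v - w *m (invmx A)^T = - ((w - v *m A^T) *m (invmx A)^T).
  by rewrite mulmxBl -mulmxA -trmx_mul mulVmx// trmx1 mulmx1 opprB.
rewrite normrN (le_trans (mulmx_norm_le _ _))// mulrAC.
by rewrite ler_wpM2l ?mulr_ge0.
Qed.

(** Continuity of g puts (x', g x') in the range where the expansion of F at
    (x, g x) is accurate, and the expansion then improves continuity to a Lipschitz
    bound at x, which turns its error term into an o(|x' - x|). *)
Lemma implicit_differentiation (R : realType) (n m : nat)
    (F : 'rV[R]_n * 'rV[R]_m -> 'rV[R]_m) (g : 'rV[R]_n -> 'rV[R]_m)
    (x : 'rV[R]_n) :
    differentiable F (x, g x) -> jacy F (x, g x) \in unitmx ->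
    {for x, continuous g} ->
    (\forall x' \near x, F (x', g x') = F (x, g x)) ->
  differentiable g x /\
  jac g x = - (invmx (jacy F (x, g x)) *m jacx F (x, g x)).
Proof.
set z := (x, g x); set B := jacy F z; set C := jacx F z => dF uB cg Fg.
set J := - (invmx B *m C); apply: differentiable_jacP => e e0.
set K := m%:R * `|(invmx B)^T|; have K0 : 0 <= K by rewrite mulr_ge0.
set L := n%:R * `|J^T|; have L0 : 0 <= L by rewrite mulr_ge0.
(* With h and k the increments of x and g, the error is K * e' * (|h| + |k|).  The
   bound 1 / 2 on K * e' lets |k| be absorbed into the left-hand side, so that |k|
   is at most (2 * L + 1) * |h|; the error is then K * e' * (2 * L + 2) * |h|, which
   the second bound makes at most e * |h|. *)
pose e' := Num.min (1 / 2) (e / (2 * L + 2)) / (K + 1).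
have m0 : 0 < Num.min (1 / 2) (e / (2 * L + 2)).
  by rewrite lt_min !divr_gt0//; lra.
have e'0 : 0 < e' by rewrite divr_gt0//; lra.
have Ke : K * e' <= Num.min (1 / 2) (e / (2 * L + 2)).
  rewrite mulrA ler_pdivrMr; last lra.
  by rewrite mulrC ler_wpM2l; lra.
have hx : h + x @[h --> (0 : 'rV[R]_n)] --> x.
  have id0 : id h @[h --> (0 : 'rV[R]_n)] --> (0 : 'rV[R]_n) by exact: cvg_id.
  rewrite -[X in _ --> X]add0r; exact: (cvgD id0 (cvg_cst x)).
have g0 : g (h + x) - g x @[h --> (0 : 'rV[R]_n)] --> (0 : 'rV[R]_m).
  rewrite -[X in _ --> X](subrr (g x)).
  exact: (cvgB (cvg_comp _ _ hx cg) (cvg_cst (g x))).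
have hk0 : (h, g (h + x) - g x) @[h --> (0 : 'rV[R]_n)] -->
    (0 : 'rV[R]_n * 'rV[R]_m).
  exact: (cvg_pair (@cvg_id _ (nbhs (0 : 'rV[R]_n))) g0).
have near_dF := hk0 _ (differentiable_dist_le dF e'0).
have F0 : \forall h \near (0 : 'rV[R]_n), F (h + x, g (h + x)) = F z.
  exact: hx Fg.
near=> h; pose k := g (h + x) - g x.
have : `|k *m B^T + h *m C^T| <= e' * (`|h| + `|k|).
  have : `|F ((h, k) + z) - F z - 'd F z (h, k)| <= e' * `|(h, k)|.
    by rewrite /k; near: h; exact: near_dF.
  have -> : (h, k) + z = (h + x, g (h + x)).
    by rewrite -[RHS]/(h + x, g (h + x)) -[LHS]/(h + x, k + g x) subrK.
  have -> : F (h + x, g (h + x)) = F z by near: h; exact: F0.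
  rewrite subrr sub0r normrN (diff_jacxy dF) addrC => /le_trans; apply.
  rewrite ler_wpM2l ?(ltW e'0)//.
  by rewrite prod_normE /= ge_max lerDl lerDr !normr_ge0.
rewrite addrC -[k *m B^T]opprK -normrN opprD !opprK => kh.
have hJ : - (h *m C^T) *m (invmx B)^T = h *m J^T.
  by rewrite /J linearN /= trmx_mul mulmxN mulmxA mulNmx.
have kJ : `|k - h *m J^T| <= K * e' * (`|h| + `|k|).
  by rewrite -hJ -mulrA; exact: solve_approx.
have kL : `|k| <= `|k - h *m J^T| + L * `|h|.
  rewrite -{1}(subrK (h *m J^T) k) (le_trans (ler_normD _ _))// lerD2l.
  by rewrite (le_trans (mulmx_norm_le _ _))// mulrAC.
have [Ke2 KeL] : K * e' <= 1 / 2 /\ K * e' * (2 * L + 2) <= e.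
  move: Ke; rewrite le_min => /andP[-> KeL]; split => //.
  by rewrite -ler_pdivlMr//; lra.
have kh2 : `|k| <= (2 * L + 1) * `|h|.
  have Ke3 := ler_wpM2r (addr_ge0 (normr_ge0 h) (normr_ge0 k)) Ke2.
  have aux (u w d l : R) : w <= d + l * u -> d <= 1 / 2 * (u + w) ->
    w <= (2 * l + 1) * u by nra.
  exact: aux kL (le_trans kJ Ke3).
apply: (le_trans kJ); apply: (@le_trans _ _ (K * e' * ((2 * L + 2) * `|h|))).
  apply: (ler_wpM2l (mulr_ge0 K0 (ltW e'0))).
  by move: kh2; lra.
by rewrite mulrA ler_wpM2r.
Unshelve. all: by end_near. Qed.

(** Mean value inequality for v |-> F (x, v) - v *m A^T, whose Jacobian measures
    how far the partial Jacobian of F is from A. *)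
Lemma linearization_norm_le (R : realType) (n m q : nat)
    (F : 'rV[R]_n * 'rV[R]_m -> 'rV[R]_q) (A : 'M[R]_(q, m)) (x : 'rV[R]_n)
    (y y' : 'rV[R]_m) (c : R) : 0 <= c ->
    (forall t : R, t \in `[0, 1] ->
      differentiable F (x, y + t *: (y' - y)) /\
      `|jacy F (x, y + t *: (y' - y)) - A| <= c) ->
  `|F (x, y') - F (x, y) - (y' - y) *m A^T| <= m%:R * `|y' - y| * c.
Proof.
move=> c0 FA; pose f v := F (x, v) - v *m A^T.
have df (t : R) : t \in `[0, 1] ->
    is_diff (y + t *: (y' - y)) f
      (fun v => v *m (jacy F (x, y + t *: (y' - y)) - A)^T).
  move=> /FA[dF _].
  have d1 := is_diff_slicey dF; rewrite /= in d1.
  have d2 := is_diff_mulmxr A^T (y + t *: (y' - y)).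
  apply: is_diff_eq (is_diffB d1 d2) _; apply/funext => v.
  by rewrite !fctE diff_jacxy// mul0mx add0r [(_ - A)^T]raddfB mulmxBr.
have -> : F (x, y') - F (x, y) - (y' - y) *m A^T = f y' - f y.
  by rewrite mulmxBl !opprB addrACA [in RHS]addrACA [- _ + _ in RHS]addrC.
apply: mean_value_norm_le => // t t01; have dft := df t t01; first exact: ex_diff.
rewrite (jac_val dft); exact: (FA t t01).2.
Qed.

(** A vector killed by B^T is almost killed by A^T, so that it is at most half as
    long as itself. *)
Lemma unitmx_of_approx (R : realType) (m : nat) (A B : 'M[R]_m) (c : R) :
    A \in unitmx -> m%:R * `|(invmx A)^T| * (m%:R * c) <= 1 / 2 ->
  `|B - A| <= c -> B \in unitmx.
Proof.
move=> uA Ac BA; rewrite -unitmx_tr -row_free_unit -kermx_eq0.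
apply/eqP/row_matrixP => i; rewrite row0.
set v := row i _; have vB : v *m B^T = 0 by apply/sub_kermxP; exact: row_sub.
have : `|v *m B^T - v *m A^T| <= m%:R * `|v| * c.
  rewrite -mulmxBr -linearB (le_trans (mulmx_norm_le _ _))//=.
  rewrite ler_wpM2l ?mulr_ge0// mx_norm_le//; first exact: le_trans BA.
  by move=> k l; rewrite mxE; exact: le_trans (entry_le_mx_norm _ _ _) BA.
move=> /(solve_approx uA); rewrite vB mul0mx subr0 => vv.
have vA := ler_wpM2r (normr_ge0 v) Ac.
apply/eqP; rewrite -normr_le0; lra.
Qed.

(** * Existence of fixed points *)

(** A map that halves distances and moves the centre by at most half the radius
    sends the closed ball into itself. *)
Lemma contraction_ball_fixpoint (R : realType) (X : completeNormedModType R)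
    (T : X -> X) (b : X) (r : R) : 0 < r ->
    (forall y y', `|b - y| <= r -> `|b - y'| <= r ->
      `|T y - T y'| <= 1 / 2 * `|y - y'|) ->
    `|T b - b| <= r / 2 ->
  exists2 y, `|b - y| <= r & T y = y.
Proof.
move=> r0 Tc Tb; pose U := closed_ball b r.
have UE y : U y = (`|b - y| <= r) by rewrite /U closed_ballE.
have Tfun : set_fun U U T.
  move=> y; rewrite !UE => yr.
  have := Tc y b yr; rewrite subrr normr0 distrC => /(_ (ltW r0)).
  have := ler_distD (T b) b (T y); rewrite (distrC b (T b)) (distrC (T b) (T y)).
  by rewrite (distrC y b); lra.
pose f : {fun U >-> U} := HB.pack T (isFun.Build _ _ U U T Tfun).
have half0 : 0 <= 1 / 2 :> R by lra.
have cf : is_contraction f.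
  exists (NngNum half0); split => /=; first lra.
  by move=> [y y'] /= []; rewrite !UE; exact: Tc.
have [||p Up fp] := banach_fixed_point cf; first exact: closed_ball_closed.
  by exists b; rewrite UE subrr normr0 ltW.
by exists p; [rewrite -UE|rewrite {2}fp].
Qed.

(** * The implicit function theorem *)

Lemma open_setX (T U : topologicalType) (A : set T) (B : set U) :
  open A -> open B -> open (A `*` B).
Proof.
move=> oA oB; rewrite openE => -[x y] [/= Ax By].
by exists (A, B) => //; split; exact: open_nbhs_nbhs.
Qed.

Lemma ball_segment (R : realType) (V : normedModType R) (b y y' : V) (r t : R) :
  t \in `[0, 1] -> ball b r y -> ball b r y' -> ball b r (y + t *: (y' - y)).
Proof.
rewrite in_itv/= => /andP[t0 t1]; rewrite -ball_normE /= => yr yr'.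
have -> : b - (y + t *: (y' - y)) = (1 - t) *: (b - y) + t *: (b - y').
  rewrite scalerBl scale1r -[RHS]addrA opprD [LHS]addrA; congr (_ + _).
  rewrite [RHS]addrC -scalerBr -scalerN; congr (_ *: _).
  by rewrite !opprB [RHS]addrC addrA subrK.
apply: le_lt_trans (ler_normD _ _) _; rewrite !normrZ !ger0_norm ?subr_ge0//.
pose s := Num.max `|b - y| `|b - y'|.
have sr : s < r by rewrite gt_max yr yr'.
apply: le_lt_trans sr.
have -> : s = (1 - t) * s + t * s by rewrite mulrBl mul1r subrK.
by rewrite lerD// ler_wpM2l ?subr_ge0// le_max lexx ?orbT.
Qed.

Theorem theorem2 (R : realType) (n m : nat) (n_ge1 : (1 <= n)%N)
    (m_ge1 : (1 <= m)%N)
    (Omega : set ('rV[R]_n * 'rV[R]_m)) (Omega_open : open Omega)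
    (F : 'rV[R]_n * 'rV[R]_m -> 'rV[R]_m)
    (F_diff : forall z, Omega z -> differentiable F z)
    (a : 'rV[R]_n) (b : 'rV[R]_m) (Omega_ab : Omega (a, b))
    (F_ab : F (a, b) = 0)
    (det_ab : \det (jacy F (a, b)) != 0)
    (jacy_cont : {for (a, b), continuous (jacy F)}) :
  exists (X : set 'rV[R]_n) (Y : set 'rV[R]_m),
    [/\ open (X `*` Y), X `*` Y `<=` Omega, (X `*` Y) (a, b) &
      exists g : 'rV[R]_n -> 'rV[R]_m,
        [/\ implicit_function F X Y g,
            forall h : 'rV[R]_n -> 'rV[R]_m,
              implicit_function F X Y h -> forall x, X x -> h x = g x,
            g a = b,
            forall x, X x ->
              [/\ differentiable g x,
                  jacy F (x, g x) \in unitmx &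
                  jac g x = - (invmx (jacy F (x, g x)) *m jacx F (x, g x))] &
            {for (a, b), continuous (jacxy F)} ->
              {for a, continuous (jac g)}]].
Proof.
set A := jacy F (a, b) in det_ab *.
have uA : A \in unitmx by rewrite unitmxE unitfE.
set P := (invmx A)^T; set K := m%:R * `|P|.
have K0 : 0 <= K by rewrite mulr_ge0.
have [c c0 Kc] : exists2 c : R, 0 < c & K * (m%:R * c) <= 1 / 2.
  have mK0 : 0 <= K * m%:R by rewrite mulr_ge0.
  exists (1 / 2 / (K * m%:R + 1)); first by rewrite !divr_gt0//; lra.
  rewrite mulrA mulrCA; apply: ler_piMr; first lra.
  by rewrite ler_pdivrMr; lra.
have [r r0 good] : exists2 r : R, 0 < r & forall x y, ball a r x -> ball b r y ->
    Omega (x, y) /\ `|jacy F (x, y) - A| <= c.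
  have : \forall z \near (a, b), Omega z /\ `|jacy F z - A| <= c.
    apply: filterI; first exact: open_nbhs_nbhs.
    have jc : \forall z \near (a, b), `|A - jacy F z| <= c.
      exact: cvgr_dist_le jacy_cont _ c0.
    by apply: filterS jc => z; rewrite distrC.
  move=> /nbhs_ballP[r r0 rgood]; exists r => // x y xr yr.
  by apply: rgood; split.
(* The contraction estimate, for the map y |-> y - F (x, y) *m P. *)
have chord x y y' : ball a r x -> ball b r y -> ball b r y' ->
    `|(y' - y) - (F (x, y') - F (x, y)) *m P| <= 1 / 2 * `|y' - y|.
  move=> xr yr yr'.
  have : `|F (x, y') - F (x, y) - (y' - y) *m A^T| <= m%:R * `|y' - y| * c.
    apply: linearization_norm_le (ltW c0) _ => t t01.
    have [Oz Az] := good x _ xr (ball_segment t01 yr yr').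
    by split => //; exact: F_diff.
  move=> /(solve_approx uA)/le_trans; apply.
  by rewrite -/P -/K [_ * c]mulrAC mulrA; exact: ler_wpM2r.
have zero_inj x y y' : ball a r x -> ball b r y -> ball b r y' ->
    F (x, y) = 0 -> F (x, y') = 0 -> y' = y.
  move=> xr yr yr' Fy Fy'; have := chord x y y' xr yr yr'.
  rewrite Fy Fy' subrr mul0mx subr0 => yy.
  by apply/eqP; rewrite -subr_eq0 -normr_le0; lra.
have sliceF x y : ball a r x -> ball b r y -> F (x', y) @[x' --> x] --> F (x, y).
  move=> xr yr; have [/F_diff dF _] := good x y xr yr.
  have d := is_diff_slicex dF.
  by apply: (differentiable_continuous (f := fun x' => F (x', y))).
(* Closeness of x to a that makes the contraction move b by at most r / 4, half
   the radius of the closed ball of radius r / 2 on which it is iterated; the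
   fixed point then lies in the open ball of radius r. *)
have [d d0 Fd] : exists2 d : R, 0 < d & forall x, ball a d x ->
    ball a r x /\ `|F (x, b) *m P| <= r / 4.
  have : \forall x \near a, ball a r x /\ `|F (x, b) *m P| <= r / 4.
    apply: filterI; first exact: nbhsx_ballx.
    have FP : F (x, b) *m P @[x --> a] --> (0 : 'rV[R]_m).
      rewrite -(mul0mx _ P) -F_ab.
      apply: (@cvg_mulmx R _ (nbhs a) _ _ _ _ (fun x => F (x, b)) (cst P)).
        by apply: sliceF; exact: ballxx.
      exact: cvg_cst.
    have r40 : 0 < r / 4 by rewrite divr_gt0.
    have FPr : \forall x \near a, `|0 - F (x, b) *m P| <= r / 4.
      exact: cvgr_dist_le FP _ r40.
    by apply: filterS FPr => x; rewrite sub0r normrN.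
  by move=> /nbhs_ballP[d d0 dP]; exists d.
have solve x : exists y, ball a d x -> `|b - y| <= r / 2 /\ F (x, y) = 0.
  have [xd|] := pselect (ball a d x); last by exists b.
  have [xr Fb] := Fd x xd.
  have half y : `|b - y| <= r / 2 -> ball b r y.
    by move=> yr; rewrite -ball_normE /=; lra.
  have [||| y yr Ty] := @contraction_ball_fixpoint R _
    (fun y => y - F (x, y) *m P) b (r / 2).
  - by rewrite divr_gt0.
  - move=> y y' /half yr /half yr'; have := chord x y' y xr yr' yr.
    by rewrite mulmxBl !opprD !opprK addrACA.
  - by rewrite addrC addKr normrN; lra.
  exists y => _; split => //.
  have FP0 : F (x, y) *m P = 0.
    by apply: oppr_inj; apply: (addrI y); rewrite Ty oppr0 addr0.
  by rewrite -[LHS]mulmx1 -trmx1 -(mulmxV uA) trmx_mul mulmxA FP0 mul0mx.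
have [g gP] := choice solve.
have gb x : ball a d x -> ball b r (g x).
  by move=> /gP[gr _]; rewrite -ball_normE /=; lra.
have gcont x : ball a d x -> {for x, continuous g}.
  move=> xd; have [xr _] := Fd x xd; have gxr := gb x xd.
  apply/(@cvgrPdist_le _ _ _ (nbhs x)) => e e0.
  have FP : F (x', g x) *m P @[x' --> x] --> (0 : 'rV[R]_m).
    rewrite -(mul0mx _ P) -(gP x xd).2.
    apply: (@cvg_mulmx R _ (nbhs x) _ _ _ _ (fun x' => F (x', g x)) (cst P)).
      exact: sliceF.
    exact: cvg_cst.
  have e20 : 0 < e / 2 by rewrite divr_gt0.
  have FPe : \forall x' \near x, `|0 - F (x', g x) *m P| <= e / 2.
    exact: cvgr_dist_le FP _ e20.
  have xX : \forall x' \near x, ball a d x'.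
    by apply: open_nbhs_nbhs; split => //; exact: ball_open.
  apply: filterS2 FPe xX => x' Fx' x'd.
  have := chord x' (g x') (g x) (Fd x' x'd).1 (gb x' x'd) gxr.
  rewrite (gP x' x'd).2 subr0 => gg.
  have := ler_normD (g x - g x' - F (x', g x) *m P) (F (x', g x) *m P).
  by rewrite subrK; move: Fx'; rewrite sub0r normrN; lra.
have gunit x : ball a d x -> jacy F (x, g x) \in unitmx.
  move=> xd; have [_ Ax] := good x (g x) (Fd x xd).1 (gb x xd).
  exact: unitmx_of_approx uA Kc Ax.
have ga : g a = b.
  by apply: (zero_inj a) => //;
    [exact: ballxx|exact: ballxx|exact/gb/ballxx|exact: (gP a (ballxx a d0)).2].
have gder x : ball a d x -> differentiable g x /\
    jac g x = - (invmx (jacy F (x, g x)) *m jacx F (x, g x)).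
  move=> xd; have [Oz _] := good x (g x) (Fd x xd).1 (gb x xd).
  apply: implicit_differentiation; [exact: F_diff|exact: gunit|exact: gcont|].
  have xX : \forall x' \near x, ball a d x'.
    by apply: open_nbhs_nbhs; split => //; exact: ball_open.
  by apply: filterS xX => x' x'd; rewrite (gP x' x'd).2 (gP x xd).2.
exists (ball a d), (ball b r); split.
- by apply: open_setX; exact: ball_open.
- by move=> [x y] [/= /Fd[xr _] yr]; have [] := good x y xr yr.
- by split; exact: ballxx.
exists g; split => //.
- by split => [x /gb //|x /gP[]].
- move=> h [hY hF] x xd; have [xr _] := Fd x xd.
  by apply: (zero_inj x) => //; [exact: gb|exact: hY|exact: (gP x xd).2|exact: hF].
- by move=> x xd; have [dg jg] := gder x xd; split => //; exact: gunit.
move=> JF.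
have gaC : (x, g x) @[x --> a] --> (a, b).
  have gab : g x @[x --> a] --> b.
    by rewrite -[X in _ --> X]ga; exact: (gcont a (ballxx a d0)).
  exact: (cvg_pair (@cvg_id _ (nbhs a)) gab).
have JFg : jacxy F (x, g x) @[x --> a] --> jacxy F (a, b).
  exact: cvg_comp _ _ gaC JF.
have jxg : jacx F (x, g x) @[x --> a] --> jacx F (a, b).
  have -> : jacx F = lsubmx \o jacxy F.
    by apply/funext => z; rewrite /jacxy /= row_mxKl.
  exact: cvg_comp _ _ JFg (@continuous_lsubmx R m n m _).
have jyg : jacy F (x, g x) @[x --> a] --> jacy F (a, b).
  exact: cvg_comp _ _ gaC jacy_cont.
have : - (invmx (jacy F (x, g x)) *m jacx F (x, g x)) @[x --> a] --> jac g a.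
  rewrite (gder a (ballxx a d0)).2 ga.
  exact: (cvgN (cvg_mulmx (cvg_invmx uA jyg) jxg)).
apply: cvg_trans; apply: (@near_eq_cvg _ _ (nbhs a)).
near=> x; have xd : ball a d x by near: x; exact: nbhsx_ballx.
by have [_ ->] := gder x xd.
Unshelve. all: by end_near. Qed.
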